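(* Let $G=((X,Y),E)$ be a split graph with $\sigma(G)=2$ and even maximum degree. Then $G$ is Class 2 if and only if $G$ is neighborhood-overfull.
   Context: All graphs are simple, finite, connected and undirected. A split graph $G=((X,Y),E)$ is a graph whose vertex set is partitioned into a clique $X$ and an independent set $Y$; $X$ is taken to be a maximal clique. A tree $t$-spanner of a connected graph $G$ is a spanning tree $T$ of $G$ with $d_T(u,w)\le t$ for every edge $uw$ of $G$. The stretch index $\sigma(G)$ is the least $t$ for which $G$ admits a tree $t$-spanner. A graph is Class 1 if its chromatic index (the minimum number of colors in a proper edge coloring) equals $\Delta(G)$, and Class 2 otherwise; by Vizing's theorem, in that case the chromatic index is $\Delta(G)+1$. A graph $H$ is overfull if $|E(H)|>\Delta(H)\cdot\lfloor |V(H)|/2\rfloor$. $G$ is neighborhood-overfull if there is a vertex $v$ with $d_G(v)=\Delta(G)$ such that the subgraph induced by $N[v]=N(v)\cup\{v\}$ is overfull. *)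

(* Defs.v *)
From mathcomp Require Import all_boot.

Set Implicit Arguments.
Unset Strict Implicit.
Unset Printing Implicit Defensive.

Record sgraph := SGraph {
  svertex :> finType;
  sedge : rel svertex;
  sg_sym : symmetric sedge;
  sg_irrefl : irreflexive sedge }.

Notation "x -- y" := (sedge x y) (at level 30).

Section Basic.
Variable G : sgraph.

Definition nbhd (x : G) : {set G} := [set y | x -- y].

Definition edges : {set {set G}} := [set [set x; y] | x in G, y in nbhd x].

Definition closed_nbhd (x : G) : {set G} := x |: nbhd x.

Definition deg (x : G) : nat := #|nbhd x|.

Definition max_deg : nat := \max_(x : G) deg x.

Definition connected : bool := [forall x : G, forall y : G, connect (@sedge G) x y].

(* A closed walk without repeated vertices; the walks [:: x; y] that run back
   and forth along one edge are not cycles of a simple graph. *)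
Definition acyclic : Prop :=
  forall c : seq G, ucycle (@sedge G) c -> size c < 3.

Definition is_tree : Prop := connected /\ acyclic.

(* The least length of a walk from x to y.  A shortest walk has fewer than #|G|
   edges; the value is #|G| when there is no walk from x to y. *)
Definition dist (x y : G) : nat :=
  find (fun k => [exists p : k.-tuple G, path (@sedge G) x p && (last x p == y)])
       (iota 0 #|G|).

Definition clique (S : {set G}) : bool :=
  [forall x in S, forall y in S, (x != y) ==> (x -- y)].

Definition independent (S : {set G}) : bool :=
  [forall x in S, forall y in S, ~~ (x -- y)].

(* X is maximal with respect to inclusion; Y may be empty. *)
Definition split_graph (X Y : {set G}) : Prop :=
  [/\ X :|: Y = [set: G], [disjoint X & Y], maxset clique X & independent Y].

Section Induced.
Variable S : {set G}.

Definition induced_edge : rel {x : G | x \in S} :=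
  fun u v => val u -- val v.

Lemma induced_sym : symmetric induced_edge.
Proof. by move=> u v; apply: sg_sym. Qed.

Lemma induced_irrefl : irreflexive induced_edge.
Proof. by move=> u; apply: sg_irrefl. Qed.

Definition induced : sgraph := SGraph induced_sym induced_irrefl.

End Induced.

Section Spanning.
Variable F : {set {set G}}.

Definition spanning_edge : rel G := fun x y => (x != y) && ([set x; y] \in F).

Lemma spanning_sym : symmetric spanning_edge.
Proof. by move=> x y; rewrite /spanning_edge eq_sym setUC. Qed.

Lemma spanning_irrefl : irreflexive spanning_edge.
Proof. by move=> x; rewrite /spanning_edge eqxx. Qed.

Definition spanning_subgraph : sgraph := SGraph spanning_sym spanning_irrefl.

End Spanning.

Definition edge_of : finType := {e : {set G} | e \in edges}.

Definition proper_edge_coloring k (c : {ffun edge_of -> 'I_k}) : bool :=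
  [forall a, forall b, (a != b) && (val a :&: val b != set0) ==> (c a != c b)].

Definition edge_colorable k : bool :=
  [exists c : {ffun edge_of -> 'I_k}, proper_edge_coloring c].

Lemma ex_edge_colorable : exists k, edge_colorable k.
Proof.
exists #|edge_of|; apply/existsP; exists [ffun a => enum_rank a].
apply/forallP=> a; apply/forallP=> b; apply/implyP=> /andP[neq_ab _].
by rewrite !ffunE (inj_eq enum_rank_inj).
Qed.

Definition chromatic_index : nat := ex_minn ex_edge_colorable.

Definition class1 : bool := chromatic_index == max_deg.

Definition class2 : bool := ~~ class1.

Definition overfull : bool := max_deg * (#|G| %/ 2) < #|edges|.

End Basic.

Arguments spanning_subgraph : clear implicits.
Arguments induced : clear implicits.

Definition neighborhood_overfull (G : sgraph) : bool :=
  [exists v : G, (deg v == max_deg G) && overfull (induced G (closed_nbhd v))].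

Definition tree_spanner (G : sgraph) (t : nat) (F : {set {set G}}) : Prop :=
  [/\ F \subset edges G, is_tree (spanning_subgraph G F)
    & forall u w : G, u -- w -> @dist (spanning_subgraph G F) u w <= t].

Definition admits_tree_spanner (G : sgraph) (t : nat) : Prop :=
  exists F : {set {set G}}, tree_spanner t F.

(* "sigma(G) = s", as a relation so that no value has to be chosen for
   disconnected graphs, which have no spanning tree. *)
Definition stretch_index_is (G : sgraph) (s : nat) : Prop :=
  admits_tree_spanner G s /\ (forall t, admits_tree_spanner G t -> s <= t).

(* Main.v *)
Require Import Defs.
From mathcomp Require Import all_boot zify.

Set Implicit Arguments.
Unset Strict Implicit.
Unset Printing Implicit Defensive.

(* A tree 2-spanner contains a star at some [c] in [X] that covers [X], and
   every vertex outside [N[c]] has degree at most 1; such vertices can be coloured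
   greedily at the end, so only [S = N[c]] matters.  If [#|S| <= Delta], colour by
   addition modulo [Delta].  Otherwise [#|S| = 2m+1] with [Delta = 2m], and since
   [G[S]] is not overfull its complement has at least [m] edges.  As [Y] is a
   clique of the complement, these include a connected graph [H] with [m] edges,
   hence on a set [W] of at most [m+1] vertices, and it suffices to colour
   [K_S - H] with [2m] colours.  Such a colouring has near-perfect matchings as
   colour classes, so each colour is missing at exactly one vertex; we prescribe
   this vertex by giving the [2m] ordered pairs [(a, b)] with [ab] in [H] distinct
   colours, each declared missing at [a].  The edges of [K_W - H] are then coloured
   greedily: such an edge sees at most [2(m-1)] colours.  Finally the
   vertices of [S \ W] are added one at a time: a new vertex is joined to the old
   ones by a matching between vertices and colours from Hall's theorem, which works
   because [#|S \ W| >= #|W| - 1], as in the embedding theorems of Cruse and of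
   Andersen and Hilton. *)

(** * Hall's theorem *)

Section Hall.
Variables R C : finType.

Definition reach (N : R -> C -> bool) (T : {set R}) : {set C} :=
  [set c | [exists r in T, N r c]].

Lemma reachP (N : R -> C -> bool) (T : {set R}) c :
  reflect (exists2 r, r \in T & N r c) (c \in reach N T).
Proof. by rewrite inE; apply: exists_inP. Qed.

(** Induction on the size of [S]. If a nonempty proper subset [T] is tight, match [T] within its
    reach and [S :\: T] outside it; Hall's condition for [U] in the rest follows from that for
    [T :|: U]. If none is tight, every nonempty proper subset has a surplus of one, so [r0] may take
    any neighbour [c1] and the condition survives the loss of [c1]. The element [c0] is only the
    value of the function when [S] is empty. *)
Lemma hall (c0 : C) (N : R -> C -> bool) (S : {set R}) :
  (forall T : {set R}, T \subset S -> #|T| <= #|reach N T|) ->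
  exists2 f : R -> C, {in S &, injective f} & forall r, r \in S -> N r (f r).
Proof.
move: {2}#|S|.+1 (ltnSn #|S|) => n.
elim: n => // n IH in N S *; rewrite ltnS => leSn hS.
have [S0|/set0Pn[r0 r0S]] := eqVneq S set0.
  by exists (fun=> c0) => [r r'|r]; rewrite S0 inE.
have [/existsP[T /and4P[sTS T0 TS /eqP tightT]]|noT] := boolP
  [exists T : {set R}, [&& T \subset S, T != set0, T != S & #|reach N T| == #|T|]].
  have ltTS : #|T| < #|S| by apply: proper_card; rewrite properEneq TS.
  have [|U sUT|f fI fN] := IH N T.
  - exact: leq_trans leSn.
  - by apply: hS; apply: subset_trans sTS.
  pose N' r c := N r c && (c \notin reach N T).
  have [|U sU|g gI gN] := IH N' (S :\: T).
  - have := cardsID T S; rewrite (setIidPr sTS) => eqS.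
    by move: T0 leSn; rewrite -card_gt0; lia.
  - have dUT : [disjoint U & T].
      by move: sU; rewrite subsetD => /andP[].
    have := hS (T :|: U); rewrite subUset sTS (subset_trans sU (subsetDl _ _)).
    move=> /(_ isT); rewrite cardsU disjoint_setI0 1?disjoint_sym // cards0 subn0.
    have: #|reach N (T :|: U)| <= #|reach N T| + #|reach N' U|.
      apply: leq_trans (leq_card_setU _ _); apply: subset_leq_card.
      apply/subsetP=> c /reachP[r]; rewrite in_setU => rTU rc.
      rewrite in_setU; case: (boolP (c \in reach N T)) => //= cT.
      apply/reachP; exists r; last by rewrite /N' rc.
      by case/orP: rTU => // rT; case/negP: cT; apply/reachP; exists r.
    by rewrite tightT; lia.
  exists (fun r => if r \in T then f r else g r) => [r r' rS r'S|r rS].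
  - have gnT s : s \in S -> s \notin T -> g s \notin reach N T.
      by move=> sS sT; have := gN s; rewrite inE sT sS => /(_ isT) /andP[].
    have fT s : s \in T -> f s \in reach N T.
      by move=> sT; apply/reachP; exists s => //; apply: fN.
    case: ifPn => rT; case: ifPn => r'T.
    + exact: fI.
    + by move=> e; case/negP: (gnT _ r'S r'T); rewrite -e fT.
    + by move=> e; case/negP: (gnT _ rS rT); rewrite e fT.
    + by apply: gI; rewrite inE ?rT ?r'T.
  - by case: ifPn => rT; [apply: fN | have := gN r; rewrite inE rT rS => /(_ isT) /andP[]].
have /card_gt0P[c1 /reachP[r1]] : 0 < #|reach N [set r0]|.
  by apply: leq_trans (hS _ _); rewrite ?cards1 ?sub1set.
rewrite inE => /eqP-> {r1} Nc1.
pose N' r c := N r c && (c != c1).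
have [|U sU|g gI gN] := IH N' (S :\ r0).
- by move: leSn; rewrite (cardsD1 r0 S) r0S.
- have [->|U0] := eqVneq U set0; first by rewrite cards0.
  have [sUS UnS] : U \subset S /\ U != S.
    move: sU; rewrite subsetD1 => /andP[-> r0U]; split=> //.
    by apply: contraNneq r0U => ->.
  have leU := hS U sUS.
  have: #|reach N U| != #|U|.
    by move: noT; rewrite negb_exists => /forallP/(_ U); rewrite sUS U0 UnS.
  have: #|reach N U| <= #|reach N' U|.+1.
    apply: leq_trans (_ : #|c1 |: reach N' U| <= _); last first.
      by rewrite cardsU1; case: (_ \notin _).
    apply: subset_leq_card; apply/subsetP=> c /reachP[r rU rc].
    rewrite in_setU1; case: eqVneq => //= cc1; apply/reachP; exists r => //.
    by rewrite /N' rc.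
  by lia.
exists (fun r => if r == r0 then c1 else g r) => [r r' rS r'S|r rS].
- have gc s : s \in S -> s != r0 -> g s != c1.
    by move=> sS sr; have := gN s; rewrite !inE sr sS => /(_ isT) /andP[].
  case: eqVneq => [->|rr0]; case: eqVneq => [->|r'r0] //.
  + by move=> e; have := gc _ r'S r'r0; rewrite e eqxx.
  + by move=> e; have := gc _ rS rr0; rewrite e eqxx.
  + by apply: gI; rewrite !inE ?rr0 ?r'r0.
- case: eqVneq => [->//|rr0].
  by have := gN r; rewrite !inE rr0 rS => /(_ isT) /andP[].
Qed.

End Hall.

(** * Greedy extension of partial colourings *)

Section PartialColoring.
Variables V C : finType.
Implicit Types col : V -> V -> option C.

(* Not required to be symmetric: a value [col a b = Some i] with [a b] a
   non-edge stands for a colour that is never used at [a]. *)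
Definition row_inj col :=
  forall a b b' i, col a b = Some i -> col a b' = Some i -> b = b'.

(** A colour merely declared missing at [a] is also seen at [a]: these are the vertices where [i] is
    no longer available. *)
Definition seen col i : {set V} := [set a | [exists b, col a b == Some i]].

Lemma seenP col i a : reflect (exists b, col a b = Some i) (a \in seen col i).
Proof. by rewrite inE; apply: (iffP existsP) => -[b e]; exists b; apply/eqP. Qed.

Definition dom col a : {set V} := [set b | col a b != None].

Lemma card_seen_at col a : row_inj col ->
  #|[set i | a \in seen col i]| = #|dom col a|.
Proof.
move=> pcol; have -> : #|dom col a| = #|[set col a b | b in dom col a]|.
  rewrite card_in_imset // => b b'; rewrite !inE.
  by case e: (col a b) => [i|] // _; case e': (col a b') => [i'|] // _ [ii'];
    apply: pcol e _; rewrite ii'.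
rewrite -(card_imset _ (@Some_inj _)); apply: eq_card => o.
apply/imsetP/imsetP => [[i + ->]|[b + ->]]; rewrite inE.
  by case/seenP=> b e; exists b; rewrite ?inE e.
case e: (col a b) => [i|] // _; exists i => //.
by rewrite inE; apply/seenP; exists b.
Qed.

Definition add_edge col x y i a b :=
  if (a == x) && (b == y) || (a == y) && (b == x) then Some i else col a b.

(** Edges are coloured one at a time. Each step adds both ends of an edge to the vertices that see
    its colour, so the parity of that set is kept. Symmetry is claimed only for the new entries,
    since the given ones may hold a different colour in each direction. *)
Lemma extend_greedy (E : rel V) col :
  symmetric E -> irreflexive E -> row_inj col ->
  (forall a b, col a b != None -> E a b) ->
  (forall a b, col a b = None -> col b a = None) ->
  (forall a b, E a b -> col a b = None -> #|E a| + #|E b| <= #|C|.+1) ->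
  exists2 col' : V -> V -> option C, row_inj col' &
    [/\ forall a b, (col' a b != None) = E a b,
        forall a b, col a b != None -> col' a b = col a b,
        forall a b, col a b = None -> col' a b = col' b a
      & forall i, odd #|seen col' i| = odd #|seen col i|].
Proof.
move=> symE irrE; pose U col := [set p : V * V | E p.1 p.2 && (col p.1 p.2 == None)].
move: {2}#|U col|.+1 (ltnSn #|U col|) => n.
elim: n => // n IH in col *; rewrite ltnS => leUn pcol subE symN degE.
have [U0|/set0Pn[[x y]]] := eqVneq (U col) set0.
  exists col => //; split=> // [a b|a b e]; last by rewrite e (symN _ _ e).
  apply/idP/idP => [/subE//|Eab].
  by apply/eqP=> e; have := in_set0 (a, b); rewrite -U0 inE /= Eab e.
rewrite inE /= => /andP[Exy /eqP cxy].
have nxy : x != y by apply: contraTneq Exy => ->; rewrite irrE.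
have dlt a b : E a b -> col a b = None -> #|dom col a| < #|E a|.
  move=> Eab cab; rewrite (cardD1 b (E a)) unfold_in Eab ltnS.
  apply: subset_leq_card; apply/subsetP=> z; rewrite !inE unfold_in => caz.
  by rewrite subE // andbT; apply: contraNneq caz => ->; rewrite cab.
(* The edge [x y] is itself uncoloured, so its ends see at most [#|E x|.-1] and [#|E y|.-1] colours,
   together fewer than [#|C|]. *)
have [i] : exists i, i \notin [set i | x \in seen col i] :|: [set i | y \in seen col i].
  apply/existsP; apply: contraT; rewrite negb_exists => /forallP full.
  have: #|C| <= #|[set i | x \in seen col i] :|: [set i | y \in seen col i]|.
    by rewrite -cardsT subset_leq_card //; apply/subsetP=> i _; have := full i; rewrite negbK.
  have := (leq_card_setU [set i | x \in seen col i] [set i | y \in seen col i]).1.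
  rewrite !card_seen_at //.
  have := dlt x y Exy cxy; rewrite symE in Exy; have := dlt y x Exy (symN _ _ cxy).
  by rewrite symE in Exy; have := degE x y Exy cxy; lia.
rewrite in_setU !(in_set (fun _ => _ \in seen _ _)) negb_or => /andP[xi yi].
pose col1 := add_edge col x y i.
have col1E a b : col a b != None -> col1 a b = col a b.
  rewrite /col1 /add_edge; case: ifP => // /orP[]/andP[/eqP-> /eqP->].
    by rewrite cxy.
  by rewrite (symN _ _ cxy).
have new a b : col1 a b != col a b -> (a, b) = (x, y) \/ (a, b) = (y, x).
  by rewrite /col1 /add_edge; case: ifP => [/orP[]/andP[/eqP-> /eqP->]|]; rewrite ?eqxx; auto.
have seen1 j : seen col1 j = if j == i then x |: (y |: seen col j) else seen col j.
  apply/setP=> a; have -> : (a \in if j == i then x |: (y |: seen col j) else seen col j) =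
    (j == i) && ((a == x) || (a == y)) || (a \in seen col j).
    by case: eqVneq => //= _; rewrite !in_setU1 orbA.
  apply/seenP/orP=> [[b]|[/andP[/eqP-> /orP[]/eqP->]|/seenP[b e]]].
  - rewrite /col1 /add_edge; case: ifP => [h [<-]|_ e]; last by right; apply/seenP; exists b.
    by left; rewrite eqxx; case/orP: h => /andP[-> _]; rewrite ?orbT.
  - by exists y; rewrite /col1 /add_edge !eqxx.
  - by exists x; rewrite /col1 /add_edge !eqxx orbT.
  - by exists b; rewrite col1E e.
have [||a b|a b|a b Eab c1ab|col2 p2 [dom2 ext2 sym2 odd2]] := IH col1.
- apply: leq_trans leUn; apply: proper_card; apply/properP; split.
    apply/subsetP=> -[a b]; rewrite !inE /= => /andP[-> /eqP].
    by rewrite /col1 /add_edge; case: ifP => // _ /eqP.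
  by exists (x, y); rewrite !inE /= Exy ?cxy // /col1 /add_edge !eqxx.
- move=> a b b' j; rewrite /col1 /add_edge.
  have yx : (y == x) = false by rewrite eq_sym (negbTE nxy).
  have nx j' z : col x z = Some j' -> j' <> i.
    by move=> e e'; case/negP: xi; apply/seenP; exists z; rewrite e e'.
  have ny j' z : col y z = Some j' -> j' <> i.
    by move=> e e'; case/negP: yi; apply/seenP; exists z; rewrite e e'.
  case: (eqVneq a x) => [->|ax]; rewrite ?(negbTE nxy) ?eqxx /= ?orbF.
    case: eqP => [->|_]; case: eqP => [->|_] //.
    - by move=> [<-] /nx.
    - by move=> /nx + [e]; rewrite e.
    - exact: pcol.
  case: (eqVneq a y) => [->|ay] /=; last exact: pcol.
  case: eqP => [->|_]; case: eqP => [->|_] //.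
  - by move=> [<-] /ny.
  - by move=> /ny + [e]; rewrite e.
  - exact: pcol.
- move=> h; case: (eqVneq (col1 a b) (col a b)) => [e|/new[][-> ->]] //.
    by apply: subE; rewrite -e.
  by rewrite symE.
- rewrite /col1 /add_edge; case: ifP => // h e; rewrite ifN; first exact: symN.
  by rewrite orbC [(b == x) && _]andbC [(b == y) && _]andbC h.
- apply: degE => //; move: c1ab; rewrite /col1 /add_edge.
  by case: ifP.
exists col2 => //; split=> // [a b cab|a b cab|j].
- by rewrite ext2 col1E.
- case: (eqVneq (col1 a b) None) => [/sym2//|c1].
  have: col1 a b != col a b by rewrite cab.
  case/new=> -[ea eb]; rewrite ea eb; rewrite !ext2 //;
    by rewrite /col1 /add_edge !eqxx ?orbT.
- rewrite odd2 seen1; case: eqP => // ->.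
  by rewrite !cardsU1 in_setU1 (negbTE nxy) (negbTE xi) yi /= negbK.
Qed.

End PartialColoring.

(** * Adding vertices to a coloured complete graph *)

Lemma card_exchange (U W : finType) (A : {set U}) (B : {set W}) (N : U -> W -> bool) :
  \sum_(a in A) #|[set b in B | N a b]| = \sum_(b in B) #|[set a in A | N a b]|.
Proof.
under eq_bigr => a _ do rewrite -sum1_card.
under [RHS]eq_bigr => b _ do rewrite -sum1_card.
rewrite (exchange_big_dep (mem B)) /=; last by move=> a b _; rewrite inE => /andP[].
apply: eq_bigr => b bB; apply: eq_bigl => a.
by rewrite !inE bB.
Qed.

Section AddVertices.
Variables V C : finType.
Implicit Types (col : V -> V -> option C) (A S : {set V}).

(** Entries that declare a colour missing count too, so each row of [A] uses exactly [#|A|.-1]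
    colours. *)
Definition on_pairs A col :=
  forall x y, (col x y != None) = [&& x \in A, y \in A & x != y].

Lemma seen_on_pairs A col i : on_pairs A col -> seen col i \subset A.
Proof.
move=> dcol; apply/subsetP=> a /seenP[b e].
by have := dcol a b; rewrite e /= => /esym/and3P[].
Qed.

(* Hall's condition is checked with [p.-1] additional rows that may only take
   the colours [i] with [#|A| < p + #|seen col i|]; then all colours are taken,
   and the tight ones must be taken by elements of [A]. *)
Lemma tight_matching (c0 : C) A col p :
  0 < p -> #|A| + p = #|C|.+1 -> row_inj col -> on_pairs A col ->
  (forall i, #|A| <= p + #|seen col i|) ->
  exists2 f : V -> C, {in A &, injective f} &
    (forall a, a \in A -> a \notin seen col (f a)) /\
    (forall i, p + #|seen col i| = #|A| -> exists2 a, a \in A & f a = i).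
Proof.
move=> p_gt0 cardA pcol dcol leA.
pose miss a := [set i in [set: C] | a \notin seen col i].
have card_miss a : a \in A -> #|miss a| = p.
  move=> aA; have := cardsC [set i | a \in seen col i].
  have -> : ~: [set i | a \in seen col i] = miss a.
    by apply/setP=> i; rewrite !inE.
  rewrite card_seen_at //.
  have -> : dom col a = A :\ a.
    by apply/setP=> b; rewrite in_set dcol in_setD1 aA /= andbC eq_sym.
  by have := cardsD1 a A; rewrite aA; lia.
have card_lack i : #|[set a in A | a \notin seen col i]| + #|seen col i| = #|A|.
  have -> : [set a in A | a \notin seen col i] = A :\: seen col i.
    by apply/setP=> a; rewrite in_set in_setD andbC.
  by rewrite cardsD (setIidPr (seen_on_pairs i dcol)) subnK // subset_leq_card // seen_on_pairs.
pose N (r : V + 'I_p.-1) i :=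
  match r with inl a => a \notin seen col i | inr _ => #|A| < p + #|seen col i| end.
pose rows := [set r : V + 'I_p.-1 | if r is inl a then a \in A else true].
have card_rows : #|rows| = #|C|.
  have -> : rows = inl @: A :|: inr @: [set: 'I_p.-1].
    apply/setP=> -[a|j]; rewrite in_set in_setU.
      rewrite (mem_imset _ _ inl_inj).
      case: imsetP => [[j _ //]|_]; by rewrite orbF.
    by rewrite (mem_imset _ _ inr_inj) in_setT orbT.
  rewrite cardsU (card_imset _ inl_inj) (card_imset _ inr_inj) cardsT card_ord.
  rewrite disjoint_setI0; last first.
    by apply/pred0P=> -[a|j] /=; apply/negbTE; rewrite negb_and;
       apply/orP; [right|left]; apply/imsetP=> -[].
  by rewrite cards0; lia.
have [T sT|f fI fN] := @hall _ _ c0 N rows.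
  pose T1 := [set a | inl a \in T].
  have T1A a : a \in T1 -> a \in A.
    by rewrite in_set => /(subsetP sT); rewrite in_set.
  have [|noinr] := boolP [exists j, inr j \in T].
    move=> /existsP[j jT].
    have leT : #|T| <= #|T1| + p.-1.
      have: T \subset inl @: T1 :|: inr @: [set: 'I_p.-1].
        apply/subsetP=> -[a|k] aT; rewrite in_setU ?(mem_imset _ _ inl_inj) ?(mem_imset _ _ inr_inj).
          by rewrite in_set aT.
        by rewrite in_setT orbT.
      move=> /subset_leq_card/leq_trans; apply; apply: leq_trans (leq_card_setU _ _) _.
      by rewrite (card_imset _ inl_inj) (card_imset _ inr_inj) cardsT card_ord.
    (* Since an extra row lies in [T], an unreached colour is tight: exactly [p] vertices of [A]
       lack it, all outside [T1]. Each vertex of [A] lacks [p] colours, so double counting gives at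
       most [#|A| - #|T1|] unreached colours. *)
    pose Z := ~: reach N T.
    have ZP i : i \in Z -> #|[set a in A | a \notin seen col i]| = p /\ forall a, a \in T1 -> a \in seen col i.
      rewrite in_setC => iZ; split.
        have: ~~ N (inr j) i by apply: contra iZ => Ni; apply/reachP; exists (inr j).
        by have := card_lack i; have := leA i; rewrite /N /=; lia.
      move=> a; rewrite in_set => aT; apply: contraR iZ => Ni.
      by apply/reachP; exists (inl a).
    have: #|Z| * p <= (#|A| - #|T1|) * p.
      have <- : #|A :\: T1| = #|A| - #|T1|.
        by rewrite cardsD (setIidPr _) //; apply/subsetP.
      rewrite -!sum_nat_const.
      rewrite (eq_bigr (fun i => #|[set a in A :\: T1 | a \notin seen col i]|)).
        rewrite -(card_exchange (A :\: T1) Z (fun a i => a \notin seen col i)).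
        apply: leq_sum => a; rewrite in_setD => /andP[_ aA].
        rewrite -(card_miss a aA); apply: subset_leq_card; apply/subsetP=> i.
        by rewrite in_set => /andP[_ h]; rewrite in_set in_setT.
      move=> i /ZP[<- h]; apply: eq_card => a; rewrite 2!in_set in_setD.
      by case: (boolP (a \in T1)) => // /h ->; rewrite andbF.
    rewrite leq_pmul2r //; have := cardsC (reach N T); rewrite -/Z.
    have: #|T1| <= #|A| by apply: subset_leq_card; apply/subsetP.
    by lia.
  have -> : #|T| = #|T1|.
    rewrite -(card_imset _ (@inl_inj V 'I_p.-1)); apply: eq_card => -[a|k].
      by rewrite (mem_imset _ _ inl_inj) in_set.
    transitivity false; last by apply/esym/imsetP=> -[].
    by apply: contraNF noinr => kT; apply/existsP; exists k.
  (* Without extra rows the usual regularity count suffices: each vertex of [A] lacks exactly [p]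
     colours and each colour is lacking at most at [p] vertices. *)
  rewrite -(leq_pmul2r p_gt0) -!sum_nat_const.
  rewrite (eq_bigr (fun a => #|[set i in reach N T | a \notin seen col i]|)).
    rewrite card_exchange; apply: leq_sum => i _.
    have : #|[set a in T1 | a \notin seen col i]| <= #|[set a in A | a \notin seen col i]|.
      apply: subset_leq_card; apply/subsetP=> a; rewrite !(in_set (fun _ => _ && _)).
      by move=> /andP[/T1A-> ->].
    by have := card_lack i; have := leA i; lia.
  move=> a aT1; rewrite -[LHS](card_miss a (T1A a aT1)).
  apply: eq_card => i; rewrite !(in_set (fun _ => _ && _)) in_setT.
  case: (boolP (a \in seen col i)) => h /=; first by rewrite andbF.
  rewrite andbT; apply/esym/reachP; exists (inl a) => //.
  by move: aT1; rewrite in_set.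
exists (f \o inl) => [a a' aA a'A /fI e|].
  by have [] : inl a = inl a' :> V + 'I_p.-1 by apply: e; rewrite in_set.
split=> [a aA|i tight].
  by have := fN (inl a); rewrite in_set; apply.
have: i \in f @: rows.
  have -> : f @: rows = [set: C].
    by apply/eqP; rewrite eqEcard subsetT cardsT card_in_imset // -card_rows leqnn.
  by rewrite in_setT.
case/imsetP=> -[a|j] rj e; first by exists a; [move: rj; rewrite in_set | rewrite e].
by have := fN _ rj; rewrite /N -e; lia.
Qed.

Definition add_star A b (f : V -> C) col x y :=
  if x \in A then (if y == b then Some (f x) else col x y)
  else if (x == b) && (y \in A) then Some (f y) else None.

(** The edge from [b] to [a] gets the colour [f a] of a tight matching. A colour used in this way is
    newly seen at both [a] and [b], so its class stays odd. Here [p] is the number of vertices still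
    to come after [b]. *)
Lemma add_vertex (c0 : C) A b col p :
  ~~ odd #|C| -> b \notin A -> #|A| + p.+1 = #|C|.+1 ->
  row_inj col -> on_pairs A col ->
  (forall i, odd #|seen col i|) -> (forall i, #|A| <= p.+1 + #|seen col i|) ->
  exists2 col', row_inj col' &
    [/\ on_pairs (b |: A) col',
        forall x y, col x y != None -> col' x y = col x y,
        forall x y, col x y = None -> col' x y = col' y x,
        forall i, odd #|seen col' i|
      & forall i, #|b |: A| <= p + #|seen col' i|].
Proof.
move=> evC bA cardA pcol dcol oddc leA.
have [f fI [fN fT]] := tight_matching c0 (ltn0Sn p) cardA pcol dcol leA.
have nAb x y : col x y != None -> (x \in A) && (y \in A).
  by rewrite dcol => /and3P[-> ->].
have neb x : x \in A -> x != b by apply: contraTneq => ->.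
pose col' := add_star A b f col; exists col'.
  move=> x y z i; rewrite /col' /add_star; case: ifP => xA.
    have fx t : col x t <> Some (f x).
      by move=> e; case/negP: (fN _ xA); apply/seenP; exists t.
    case: eqP => [->|_]; case: eqP => [->|_] //.
    - by move=> [<-] /fx.
    - by move=> + [e]; rewrite -e => /fx.
    - exact: pcol.
  case: ifP => // /andP[_ yA] [<-]; case: ifP => // /andP[_ zA] [].
  by move/fI=> ->.
have old x y : col x y != None -> col' x y = col x y.
  by move=> /nAb /andP[xA yA]; rewrite /col' /add_star xA (negbTE (neb _ yA)).
have seen' i : seen col' i =
    if [exists a in A, f a == i] then b |: ([set a in A | f a == i] :|: seen col i) else seen col i.
  apply/setP=> x; apply/seenP/idP=> [[y]|].
    rewrite /col' /add_star; case: ifP => xA.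
      case: eqP => _ [e].
        rewrite ifT; last by apply/existsP; exists x; rewrite xA e eqxx.
        by rewrite in_setU1 in_setU in_set xA e eqxx orbT.
      have xs : x \in seen col i by apply/seenP; exists y.
      by case: ifP => //; rewrite in_setU1 in_setU xs !orbT.
    case: ifP => // /andP[/eqP-> yA] [e].
    rewrite ifT ?setU11 //; apply/existsP; exists y; by rewrite yA e eqxx.
  have keep : x \in seen col i -> exists y, col' x y = Some i.
    by case/seenP=> y e; exists y; rewrite old e.
  case: existsP => // -[a /andP[aA /eqP fa]]; rewrite in_setU1 in_setU in_set.
  case/or3P=> [/eqP->|/andP[xA /eqP e]|//].
    by exists a; rewrite /col' /add_star (negbTE bA) eqxx aA /= fa.
  by exists b; rewrite /col' /add_star xA eqxx e.
have bseen i : b \notin seen col i by apply: contra bA; apply/subsetP/seen_on_pairs.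
have card_seen' i : #|seen col' i| = if [exists a in A, f a == i] then #|seen col i|.+2 else #|seen col i|.
  rewrite seen'; case: existsP => // -[a /andP[aA /eqP fa]].
  have -> : [set a in A | f a == i] = [set a].
    apply/setP=> x; rewrite in_set in_set1; apply/andP/eqP=> [[xA /eqP fx]|->].
      by apply: fI; rewrite // fx.
    by rewrite aA fa.
  rewrite !cardsU1 in_setU1 negb_or bseen eq_sym (neb _ aA) /=.
  by rewrite -fa fN.
split=> // [x y|x y|i|i].
- rewrite !in_setU1 /col' /add_star; case: (boolP (x \in A)) => xA.
    rewrite orbT /=; case: (eqVneq y b) => [->|_] /=; first by rewrite neb.
    by rewrite dcol xA.
  rewrite orbF; case: (eqVneq x b) => //= ->; case: (boolP (y \in A)) => yA.
    by rewrite orbT [b == y]eq_sym neb.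
  by rewrite orbF [b == y]eq_sym andbN.
- move=> e; have := dcol x y; rewrite e eqxx /= => /esym.
  rewrite /col' /add_star; case: (boolP (x \in A)) => xA; case: (boolP (y \in A)) => yA /=.
  + by move=> /negbFE/eqP->.
  + by rewrite andbT e.
  + rewrite andbT; suff -> : col y x = None by [].
    by apply/eqP; apply: contraT => /nAb; rewrite (negbTE xA) andbF.
  + by rewrite !andbF.
- by rewrite card_seen'; case: ifP => _; rewrite ?oddS ?negbK oddc.
- rewrite cardsU1 bA card_seen'; have := leA i; case: ifP => [_|/negbT/exists_inPn h]; first by lia.
  have : p.+1 + #|seen col i| <> #|A| by move=> /fT[a aA e]; have := h _ aA; rewrite e eqxx.
  have evA : ~~ odd (#|A| + p) by move: cardA; rewrite addnS => -[->].
  by have := oddc i; rewrite add1n; lia.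
Qed.

(** In the end all [#|C|] colours are seen at each of the [#|C|.+1] vertices of [S]. A vertex of [A]
    that still lacks [i] must therefore get it on an edge into [S :\: A], and these edges form a
    matching; hence the last hypothesis. It is the invariant under which vertices are added one by
    one. *)
Lemma extend_to_superset (c0 : C) A S col :
  ~~ odd #|C| -> A \subset S -> #|S| = #|C|.+1 ->
  row_inj col -> on_pairs A col ->
  (forall i, odd #|seen col i|) -> (forall i, #|A| <= #|S :\: A| + #|seen col i|) ->
  exists2 col', row_inj col' &
    [/\ on_pairs S col',
        forall x y, col x y != None -> col' x y = col x y
      & forall x y, col x y = None -> col' x y = col' y x].
Proof.
move=> evC; move: {2}#|S :\: A| (erefl #|S :\: A|) => n.
elim: n A col => [|n IH] A col cardn sAS cardS pcol dcol oddc leA.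
  have eAS : A = S.
    by apply/eqP; rewrite eqEsubset sAS -setD_eq0 -cards_eq0 cardn.
  exists col => //; split=> //; first by rewrite -eAS.
  move=> x y e; rewrite e; have := dcol x y; have := dcol y x.
  by rewrite e eqxx [y == x]eq_sym [(y \in A) && _]andbCA => + h; rewrite -h => /negbFE/eqP.
have /card_gt0P[b] : 0 < #|S :\: A| by rewrite cardn.
rewrite in_setD => /andP[bA bS].
have cardA : #|A| + n.+1 = #|C|.+1.
  by rewrite -cardS -cardn -(cardsID A S) (setIidPr sAS).
have [|col1 p1 [d1 e1 s1 o1 l1]] := add_vertex c0 evC bA cardA pcol dcol oddc.
  by move=> i; rewrite -cardn.
have cardn' : #|S :\: (b |: A)| = n.
  have := cardsD1 b (S :\: A); rewrite in_setD bA bS cardn.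
  by rewrite setDDl setUC => -[].
have [|i|col2 p2 [d2 e2 s2]] := IH (b |: A) col1 cardn' _ cardS p1 d1 o1.
- by rewrite subUset sub1set bS.
- by rewrite cardn'.
exists col2 => //; split=> // [x y h|x y h].
  by rewrite e2 e1 // e1.
have [/s2//|c1] := eqVneq (col1 x y) None.
by rewrite !e2 -?(s1 x y h) // s1.
Qed.

End AddVertices.

(** * Complete graphs minus a connected graph *)

Lemma color_darts (T C : finType) (H : {set T}) (c0 : C) : #|H| = #|C| ->
  exists2 g : T -> C, {in H &, injective g} & forall i, exists2 p, p \in H & g p = i.
Proof.
move=> cardH; pose g p := nth c0 (enum C) (index p (enum H)); exists g.
  move=> p q pH qH /eqP; rewrite nth_uniq ?enum_uniq //.
  - by move=> /eqP; apply: index_inj; rewrite ?mem_enum.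
  - by rewrite -cardE -cardH cardE index_mem mem_enum.
  - by rewrite -cardE -cardH cardE index_mem mem_enum.
move=> i; have ltiH : index i (enum C) < size (enum H).
  by rewrite -cardE cardH cardE index_mem mem_enum.
have /card_gt0P[p0 _] : 0 < #|H| by rewrite cardE (leq_ltn_trans _ ltiH).
exists (nth p0 (enum H) (index i (enum C))); first by rewrite -mem_enum mem_nth.
by rewrite /g index_uniq ?enum_uniq // nth_index ?mem_enum.
Qed.

Section Deleted.
Variables V C : finType.

(* Each ordered pair [(a, b)] of [H] receives its own colour, the one that is
   never used at [a]; the count [#|H| = #|C|] says that no colour is left. *)
Lemma color_minus (c0 : C) (S W : {set V}) (H : {set V * V}) :
  ~~ odd #|C| -> #|S| = #|C|.+1 -> W \subset S -> #|W|.*2 <= #|C|.+2 ->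
  #|H| = #|C| -> (forall a b, ((a, b) \in H) = ((b, a) \in H)) ->
  (forall a b, (a, b) \in H -> [&& a \in W, b \in W & a != b]) ->
  exists2 col : V -> V -> option C, row_inj col &
    on_pairs S col /\ forall a b, (a, b) \notin H -> col a b = col b a.
Proof.
move=> evC cardS sWS cardW cardH symH subH.
have [g gI gS] := color_darts c0 cardH.
pose col0 a b := if (a, b) \in H then Some (g (a, b)) else None.
have p0 : row_inj col0.
  move=> a b b' i; rewrite /col0; case: ifP => // h [gi]; case: ifP => // h' [gi'].
  by have [] : (a, b) = (a, b') by apply: gI => //; rewrite gi.
have d0 a b : (col0 a b != None) = ((a, b) \in H) by rewrite /col0; case: ifP.
have n0 a b : col0 a b = None -> (a, b) \notin H by rewrite -d0 => ->.
have seen0 i : #|seen col0 i| = 1.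
  have [[a b] abH gab] := gS i; rewrite (_ : seen col0 i = [set a]) ?cards1 //.
  apply/setP=> x; rewrite in_set1; apply/seenP/eqP=> [[y]|->].
    rewrite /col0; case: ifP => // h [e].
    by have [] : (x, y) = (a, b) by apply: gI => //; rewrite e.
  by exists b; rewrite /col0 abH gab.
pose E a b := [&& a \in W, b \in W & a != b].
have card_nbrs a : a \in W -> #|E a| = #|W|.-1.
  move=> aW; rewrite (cardsD1 a W) aW add1n; apply: eq_card => b.
  by rewrite unfold_in in_setD1 /E aW /= andbC eq_sym.
have [||a b|a b|a b|col1 p1 [d1 e1 s1 o1]] := @extend_greedy V C E col0 _ _ p0.
- by move=> a b; rewrite /E eq_sym andbCA.
- by move=> a; rewrite /E eqxx !andbF.
- by rewrite d0 => /subH.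
- by move=> /n0; rewrite symH => /negbTE; rewrite /col0 => ->.
- move=> /and3P[aW bW _] _.
  by rewrite (card_nbrs a aW) (card_nbrs b bW); lia.
have odd1 i : odd #|seen col1 i| by rewrite o1 seen0.
(* An odd class is nonempty, and the bound on [W] reads [#|W|.*2 <= #|S|.+1]; so
   [#|W| <= #|S :\: W| + 1], as the extension requires. *)
have [|col2 p2 [d2 e2 s2]] := extend_to_superset c0 evC sWS cardS p1 d1 odd1.
  move=> i; have := odd_gt0 (odd1 i); rewrite cardsD (setIidPr sWS).
  by have := subset_leq_card sWS; lia.
exists col2 => //; split=> // a b /negbTE abH.
have [/s2//|c1] := eqVneq (col1 a b) None.
have sym1 : col1 a b = col1 b a by apply: s1; rewrite /col0 abH.
by rewrite !e2 // -sym1.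
Qed.

(** The hypothesis on [y0] makes the edges of [K] span one connected graph. Starting from [y0], each
    new edge touches [W] and so enlarges it by at most one vertex. Sizes are doubled because [H]
    holds both orientations of each edge. *)
Lemma grow_connected (K : rel V) (S : {set V}) y0 n :
  symmetric K -> irreflexive K -> y0 \in S -> (forall a b, K a b -> b \in S) ->
  (forall a b, K a b -> [|| a == y0, b == y0, K y0 a | K y0 b]) ->
  n.*2 <= #|[set p | K p.1 p.2]| ->
  exists (H : {set V * V}) (W : {set V}),
    [/\ forall a b, ((a, b) \in H) = ((b, a) \in H),
        forall a b, (a, b) \in H -> [&& K a b, a \in W & b \in W],
        #|H| = n.*2, y0 \in W & W \subset S /\ #|W| <= n.+1].
Proof.
move=> symK irrK y0S subK hub; elim: n => [|n IH] leK.
  exists set0, [set y0]; split=> [a b|a b|||]; rewrite ?inE ?cards0 ?cards1 //.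
  by rewrite sub1set.
have [|H [W [symH subH cardH y0W [sWS leW]]]] := IH; first by lia.
have [a [b [Kab abH aW]]] : exists a b, [/\ K a b, (a, b) \notin H & a \in W].
  have /card_gt0P[[a b]] : 0 < #|[set p | K p.1 p.2] :\: H|.
    rewrite cardsD subn_gt0; apply: leq_ltn_trans (subset_leq_card (subsetIr _ _)) _.
    by rewrite cardH; apply: leq_trans leK; rewrite doubleS ltnS leqnSn.
  rewrite !inE /= => /andP[abH Kab].
  have [aW|aW] := boolP (a \in W); first by exists a, b.
  have [bW|bW] := boolP (b \in W); first by exists b, a; rewrite symK symH.
  have out x : x \notin W -> (y0, x) \notin H.
    by apply: contra => /subH/and3P[].
  have ne x : x \notin W -> (x == y0) = false by apply: contraNF => /eqP->.
  have := hub _ _ Kab; rewrite !ne //= => /orP[] Ky.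
    by exists y0, a; rewrite Ky out.
  by exists y0, b; rewrite Ky out.
have nab : a != b by apply: contraTneq Kab => ->; rewrite irrK.
exists ((a, b) |: ((b, a) |: H)), (b |: W); split.
- move=> x y; rewrite !in_setU1 symH !xpair_eqE orbCA.
  by rewrite [(x == b) && _]andbC [(x == a) && _]andbC.
- move=> x y; rewrite !in_setU1 !xpair_eqE.
  case/or3P=> [/andP[/eqP-> /eqP->]|/andP[/eqP-> /eqP->]|/subH/and3P[-> -> ->]].
  + by rewrite Kab aW eqxx orbT.
  + by rewrite symK Kab aW eqxx orbT.
  + by rewrite !orbT.
- by rewrite !cardsU1 in_setU1 xpair_eqE (negbTE nab) abH symH abH cardH.
- by rewrite in_setU1 y0W orbT.
- rewrite subUset sub1set sWS (subK _ _ Kab); split=> //.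
  by rewrite cardsU1; case: (_ \notin _); lia.
Qed.

End Deleted.

Lemma card_pairs (V : finType) (K : rel V) :
  #|[set p | K p.1 p.2]| = \sum_x #|[set y | K x y]|.
Proof.
under eq_bigr => x _ do rewrite -sum1_card.
by rewrite pair_big_dep -sum1_card; apply: eq_bigl => -[x y]; rewrite !inE.
Qed.

(** * Chromatic index and overfull graphs *)

Section Graph.
Variable G : sgraph.

Lemma edge_neq (x y : G) : x -- y -> x != y.
Proof. by apply: contraTneq => ->; rewrite sg_irrefl. Qed.

Lemma set2_inj (x y z : G) : [set x; y] = [set x; z] -> y = z.
Proof.
move=> e; have yxz : y \in [set x; z] by rewrite -e set22.
have : z \in [set x; y] by rewrite e set22.
by move: yxz; rewrite !in_set2 => /orP[/eqP yx|/eqP->//] /orP[]/eqP->.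
Qed.

Lemma mem_edges (x y : G) : ([set x; y] \in edges G) = (x -- y).
Proof.
apply/imset2P/idP=> [[u v _]|xy]; last by exists x y; rewrite ?inE.
rewrite inE => uv e; have nuv := edge_neq uv.
have : u \in [set x; y] by rewrite e set21.
have : v \in [set x; y] by rewrite e set22.
rewrite !in_set2 => /orP[]/eqP ev /orP[]/eqP eu; move: uv nuv; rewrite eu ev ?eqxx //.
by rewrite sg_sym.
Qed.

Lemma edgesP e : reflect (exists x y : G, x -- y /\ e = [set x; y]) (e \in edges G).
Proof.
apply: (iffP imset2P) => [[x y _]|[x [y [xy ->]]]].
  by rewrite inE => xy ->; exists x, y.
by exists x y; rewrite ?inE.
Qed.

(** Colourings of the type of edges are traded for functions of two vertices. Only the values on
    edges must be defined and symmetric, so a function that also has values on non-edges will do. *)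
Lemma edge_colorableP k :
  reflect (exists2 f : G -> G -> option 'I_k, row_inj f &
             forall x y, x -- y -> f x y != None /\ f x y = f y x)
          (edge_colorable G k).
Proof.
apply: (iffP existsP) => [[c /forallP/(_ _)/forallP pc]|[f fI fE]].
  pose f x y := omap c (insub [set x; y] : option (edge_of G)).
  exists f => [x y z i|x y xy].
    rewrite /f; case: insubP => // e _ ve /= [<-]; case: insubP => // e' _ ve' /= [cc].
    case: (eqVneq e e') => [ee'|ne]; first by apply: (@set2_inj x); rewrite -ve -ve' ee'.
    have := pc e e'; rewrite ne cc eqxx /= implybF => /negP[].
    by apply/set0Pn; exists x; rewrite inE ve ve' !set21.
  by rewrite /f setUC; split=> //; rewrite insubT ?mem_edges // sg_sym.
have /fin_all_exists[c cE] (e : edge_of G) : exists i, forall z, z \in val e ->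
    exists y, val e = [set z; y] /\ f z y = Some i.
  have /edgesP[x [y [xy ->]]] := valP e.
  have [] := fE _ _ xy; case fxy: (f x y) => [i|] // _ fyx; exists i => z.
  rewrite in_set2 => /orP[]/eqP->; first by exists y.
  by exists x; rewrite setUC.
exists (finfun c); apply/forallP=> a; apply/forallP=> b; apply/implyP=> /andP[nab].
case/set0Pn=> z; rewrite inE => /andP[za zb]; rewrite !ffunE.
apply: contra nab => /eqP cab; apply/eqP/val_inj.
have [y [-> fy]] := cE _ _ za; have [y' [-> fy']] := cE _ _ zb.
by rewrite (fI _ _ _ _ fy (etrans fy' (congr1 _ (esym cab)))).
Qed.

Lemma max_deg_le_colors k : edge_colorable G k -> max_deg G <= k.
Proof.
move=> /edge_colorableP[f fI fE]; apply/bigmax_leqP=> x _.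
apply: leq_trans (_ : #|dom f x| <= _).
  by apply: subset_leq_card; apply/subsetP=> y; rewrite !inE => /fE[].
by rewrite -card_seen_at // -[X in _ <= X]card_ord max_card.
Qed.

Lemma class1E : class1 G = edge_colorable G (max_deg G).
Proof.
rewrite /class1 /chromatic_index; case: ex_minnP => k kc kmin.
apply/eqP/idP=> [<-//|/kmin ?]; apply/eqP.
by rewrite eqn_leq max_deg_le_colors // andbT.
Qed.

(** Each colour class is a matching: its edges are disjoint pairs of vertices, at most [#|G| %/ 2]
    of them. *)
Lemma edges_le_colors k : edge_colorable G k -> #|edges G| <= k * (#|G| %/ 2).
Proof.
move=> /existsP[c /forallP/(_ _)/forallP pc].
rewrite -(card_sig (mem (edges G))) -[#|{: _}|]sum1_card.
rewrite (partition_big c xpredT) //= -[X in X * _]card_ord -sum_nat_const.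
apply: leq_sum => i _; rewrite leq_divRL // sum1_card.
pose M := val @: [set a | c a == i].
have cM : #|[pred a | c a == i]| = #|M|.
  by rewrite card_imset; [apply: eq_card => a; rewrite inE | apply: val_inj].
have /eqP tM : trivIset M.
  apply/trivIsetP=> _ _ /imsetP[a + ->] /imsetP[b + ->]; rewrite !inE => /eqP ca /eqP cb nab.
  rewrite -setI_eq0; apply: contraT => h; have := pc a b.
  by rewrite h andbT ca cb eqxx implybF negbK => /eqP e; rewrite e eqxx in nab.
rewrite cM -sum_nat_const; apply: leq_trans (max_card (mem (cover M))).
rewrite -tM; apply: leq_sum => _ /imsetP[a _ ->].
have /edgesP[x [y [xy ->]]] := valP a.
by rewrite cards2 (edge_neq xy).
Qed.

Lemma sum_deg_le : \sum_(x : G) deg x <= #|edges G|.*2.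
Proof.
have -> : #|edges G|.*2 = \sum_(e in edges G) #|[set x in [set: G] | x \in e]|.
  rewrite -muln2 -sum_nat_const; apply: eq_bigr => e /edgesP[x [y [xy ->]]].
  by rewrite (_ : [set x0 in _ | _] = [set x; y]) ?cards2 ?edge_neq //; apply/setP=> z; rewrite !inE.
rewrite -(card_exchange [set: G] (edges G) (fun x e => x \in e)).
rewrite [X in _ <= X](eq_bigl xpredT); last by move=> x; rewrite inE.
apply: leq_sum => x _; rewrite /deg -(card_imset _ (@set2_inj x)).
apply: subset_leq_card; apply/subsetP=> _ /imsetP[y xy ->].
by rewrite inE set21 andbT mem_edges; rewrite inE in xy.
Qed.

Lemma deg_le_max (x : G) : deg x <= max_deg G.
Proof. exact: leq_bigmax. Qed.

End Graph.

(** * Induced subgraphs and the easy implication *)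

Section InducedDegree.
Variables (G : sgraph) (S : {set G}).

Lemma deg_induced (u : induced G S) : deg u = #|[set y in S | val u -- y]|.
Proof.
rewrite /deg -(card_imset _ val_inj); apply: eq_card => y.
rewrite inE; apply/imsetP/andP=> [[v + ->]|[yS uy]].
  by rewrite inE => uv; split=> //; apply: valP.
by exists (Sub y yS); rewrite ?inE ?SubK.
Qed.

Lemma max_deg_induced : max_deg (induced G S) <= max_deg G.
Proof.
apply/bigmax_leqP=> u _; rewrite deg_induced; apply: leq_trans (deg_le_max (val u)).
by apply: subset_leq_card; apply/subsetP=> y; rewrite !inE => /andP[].
Qed.

Lemma card_induced : #|induced G S| = #|S|.
Proof. exact: card_sig. Qed.

Lemma sum_induced (F : G -> nat) : \sum_(u : induced G S) F (val u) = \sum_(x in S) F x.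
Proof.
rewrite (reindex_omap (val : induced G S -> G) insub) /=.
  by apply: eq_bigl => u; rewrite valK eqxx andbT (valP u).
by move=> x xS; rewrite insubT.
Qed.

Lemma edge_colorable_induced k : edge_colorable G k -> edge_colorable (induced G S) k.
Proof.
move=> /edge_colorableP[f fI fE]; apply/edge_colorableP.
exists (fun u v => f (val u) (val v)) => [u v w i e e'|u v uv]; last exact: fE.
by apply: val_inj; apply: fI e e'.
Qed.

End InducedDegree.

(** A colouring with [max_deg G] colours would restrict to the closed neighbourhood of [v]. There
    [v] keeps its full degree, so the bound by matchings contradicts overfullness. *)
Lemma neighborhood_overfull_class2 (G : sgraph) : neighborhood_overfull G -> class2 G.
Proof.
move=> /existsP[v /andP[/eqP dv over]]; rewrite /class2 class1E.
apply: contraL over => /(edge_colorable_induced (closed_nbhd v))/edges_le_colors.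
rewrite /overfull -leqNgt => /leq_trans; apply; rewrite leq_mul2r -{1}dv; apply/orP; right.
have vN : v \in closed_nbhd v by rewrite setU11.
apply: leq_trans (deg_le_max (Sub v vN : induced G (closed_nbhd v))).
rewrite deg_induced SubK; apply: subset_leq_card; apply/subsetP=> y.
by rewrite !inE => ->; rewrite orbT.
Qed.

(** * Split graphs with a central vertex *)

Section Star.
Variable G : sgraph.

(* Addition modulo [k] colours a complete graph on at most [k] vertices. *)
Lemma color_small (S : {set G}) k : #|S| <= k ->
  exists2 col : G -> G -> option 'I_k, row_inj col &
    forall x y, x \in S -> y \in S -> x -- y -> col x y != None /\ col x y = col y x.
Proof.
case: k => [|k] leS.
  exists (fun _ _ => None) => // x y xS.
  by move: leS; rewrite leqn0 cards_eq0 => /eqP S0; rewrite S0 inE in xS.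
pose h x y : 'I_k.+1 := Ordinal (ltn_pmod (index x (enum S) + index y (enum S)) (ltn0Sn k)).
exists (fun x y => if (x \in S) && (y \in S) then Some (h x y) else None).
  have lt_index z : z \in S -> index z (enum S) < k.+1.
    by move=> zS; apply: leq_trans leS; rewrite cardE index_mem mem_enum.
  move=> x y z i; case: ifP => // /andP[xS yS] [<-]; case: ifP => // /andP[_ zS] [].
  move/eqP; rewrite eqn_modDl !modn_small ?lt_index // => /eqP.
  by move/index_inj => ->; rewrite ?mem_enum.
move=> x y xS yS _; rewrite xS yS; split=> //.
by congr Some; apply: val_inj; rewrite /= addnC.
Qed.

(** Of the $(2k+1)2k$ ordered pairs of distinct vertices of [S], at most $2 \cdot 2k^2$ are
    adjacent, which leaves at least $2k$. *)
Lemma non_adjacent_ge (S : {set G}) k :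
  #|S| = k.*2.+1 -> #|edges (induced G S)| <= k.*2 * k ->
  k.*2 <= #|[set p : G * G | [&& p.1 \in S, p.2 \in S, p.1 != p.2 & ~~ (p.1 -- p.2)]]|.
Proof.
move=> cardS leE.
rewrite (card_pairs (fun x y => [&& x \in S, y \in S, x != y & ~~ (x -- y)])).
rewrite (bigID (mem S)) /=; apply: leq_trans (leq_addr _ _).
have nonadj x : x \in S ->
    #|[set y | [&& x \in S, y \in S, x != y & ~~ (x -- y)]]| + #|[set y in S | x -- y]| = k.*2.
  move=> xS; rewrite -cardsUI disjoint_setI0 ?cards0 ?addn0; last first.
    by apply/pred0P=> y /=; rewrite !inE; case: (x -- y); rewrite ?andbF.
  have -> : [set y | [&& x \in S, y \in S, x != y & ~~ (x -- y)]] :|: [set y in S | x -- y]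
      = S :\ x.
    apply/setP=> y; rewrite !inE xS /= [y == x]eq_sym.
    have := @edge_neq G x y; case: (x -- y); case: (x == y); case: (y \in S) => //=.
    by move=> /(_ isT).
  by have := cardsD1 x S; rewrite xS cardS => -[].
have : \sum_(x in S) #|[set y | [&& x \in S, y \in S, x != y & ~~ (x -- y)]]|
     + \sum_(x in S) #|[set y in S | x -- y]| = k.*2.+1 * k.*2.
  by rewrite -big_split -cardS -sum_nat_const; apply: eq_bigr => x /nonadj.
rewrite -(sum_induced S (fun x => #|[set y in S | x -- y]|)).
under [X in _ + X = _]eq_bigr => u _ do rewrite -deg_induced.
have := sum_deg_le (induced G S); move: leE; rewrite mulSn -!muln2.
lia.
Qed.

Variables X Y : {set G}.
Hypothesis splitXY : split_graph X Y.

Lemma split_clique x y : x \in X -> y \in X -> x != y -> x -- y.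
Proof.
case: splitXY => _ _ /maxsetp/forall_inP cX _ xX yX.
by apply/implyP; move/forall_inP: (cX x xX); apply.
Qed.

Lemma split_indep x y : x \in Y -> y \in Y -> ~~ (x -- y).
Proof. by case: splitXY => _ _ _ /forall_inP iY xY; move/forall_inP: (iY x xY); apply. Qed.

Lemma split_cover x : (x \in X) || (x \in Y).
Proof. by case: splitXY => e _ _ _; rewrite -in_setU e inE. Qed.

Lemma color_center (c : G) : ~~ odd (max_deg G) -> ~~ neighborhood_overfull G ->
  exists2 col : G -> G -> option 'I_(max_deg G), row_inj col &
    forall x y, x \in closed_nbhd c -> y \in closed_nbhd c -> x -- y ->
      col x y != None /\ col x y = col y x.
Proof.
move=> evD nover; set S := closed_nbhd c.
have cardS : #|S| = (deg c).+1 by rewrite cardsU1 inE sg_irrefl.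
have [|ltD] := leqP #|S| (max_deg G); first exact: color_small.
have degc : deg c = max_deg G by apply/eqP; rewrite eqn_leq deg_le_max -ltnS -cardS.
(* With maximum degree 0 there are no edges; otherwise colour 0 exists and serves as the default
   colour of [color_minus]. *)
have [D0|D_gt0] := posnP (max_deg G).
  exists (fun _ _ => None) => // x y _ _ xy; have := deg_le_max x.
  by rewrite D0 leqn0 cards_eq0 => /eqP N0; have := in_set0 y; rewrite -N0 inE xy.
have eqD : max_deg G = (max_deg G)./2.*2 by rewrite even_halfK.
(* Here [#|S|] is [(max_deg G).+1], which is odd, so the floor in the definition of overfull is half
   the maximum degree. *)
have leE : #|edges (induced G S)| <= (max_deg G)./2.*2 * (max_deg G)./2.
  have := nover; rewrite negb_exists => /forallP/(_ c).
  rewrite degc eqxx /= /overfull -leqNgt card_induced -/S cardS degc => /leq_trans; apply.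
  by apply: leq_mul; [rewrite -eqD max_deg_induced | rewrite divn2 -uphalfE uphalf_half (negbTE evD)].
pose K x y := [&& x \in S, y \in S, x != y & ~~ (x -- y)].
have leK : (max_deg G)./2.*2 <= #|[set p | K p.1 p.2]|.
  by apply: non_adjacent_ge leE; rewrite cardS degc {1}eqD.
have symK : symmetric K by move=> x y; rewrite /K andbCA eq_sym sg_sym.
have irrK : irreflexive K by move=> x; rewrite /K eqxx !andbF.
have K_Y x y : K x y -> (x \in Y) || (y \in Y).
  case/and4P=> _ _ nxy; apply: contraR; rewrite negb_or => /andP[xY yY].
  by apply: split_clique => //; [move: (split_cover x) | move: (split_cover y)];
     rewrite ?(negbTE xY) ?(negbTE yY) orbF.
have [y0 y0S y0Y] : exists2 y, y \in S & y \in Y.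
  have /card_gt0P[[x y]] : 0 < #|[set p | K p.1 p.2]| by rewrite (leq_trans _ leK) // -eqD.
  rewrite inE /= => Kxy; have /and4P[xS yS _ _] := Kxy.
  by case/orP: (K_Y _ _ Kxy); [exists x | exists y].
(* Every pair of [K] has an end in [Y], and this end is [y0] or a [K]-neighbour of [y0]; so [y0] can
   serve as the starting vertex of [grow_connected]. *)
have K_y0 x : x \in S -> x \in Y -> (x == y0) || K y0 x.
  by move=> xS xY; rewrite /K y0S xS split_indep // andbT /= eq_sym orbN.
have [||H [W [symH subH cardH y0W [sWS leW]]]] := grow_connected symK irrK y0S _ _ leK.
- by move=> a b /and4P[].
- move=> a b Kab; have /and4P[aS bS _ _] := Kab.
  by case/orP: (K_Y _ _ Kab) => [/(K_y0 _ aS)|/(K_y0 _ bS)] /orP[->|->]; rewrite ?orbT.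
- have [||||||a b|col pcol [dcol scol]] := @color_minus G 'I_(max_deg G) (Ordinal D_gt0) S W H.
  + by rewrite card_ord.
  + by rewrite card_ord cardS degc.
  + exact: sWS.
  + by rewrite card_ord {1}eqD -doubleS leq_double.
  + by rewrite card_ord cardH -eqD.
  + exact: symH.
  + by case/subH/and3P=> /and4P[_ _ nab _] -> ->.
  exists col => // x y xS yS xy; split; first by rewrite dcol xS yS edge_neq.
  apply: scol; apply/negP => /subH/and3P[/and4P[_ _ _]].
  by rewrite xy.
Qed.

(** An edge not inside [N[c]] has an end of degree at most 1, so the degrees of its ends sum to at
    most [(max_deg G).+1] and the greedy extension applies. *)
Lemma color_from_center (c : G) : (forall y, y \notin closed_nbhd c -> deg y <= 1) ->
  ~~ odd (max_deg G) -> ~~ neighborhood_overfull G -> edge_colorable G (max_deg G).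
Proof.
move=> pendant evD nover; have [col pcol scol] := color_center c evD nover.
set S := closed_nbhd c in pendant scol.
(* The colouring of [N[c]] may also assign colours to non-edges; these are dropped, which frees them
   for the edges leaving [N[c]]. *)
pose col0 x y := if [&& x \in S, y \in S & x -- y] then col x y else None.
have colN x y : col0 x y = None -> x -- y -> (x \notin S) || (y \notin S).
  rewrite /col0 => + xy; case: (boolP (x \in S)) => //= xS; case: (boolP (y \in S)) => //= yS.
  by rewrite xy; have [] := scol x y xS yS xy; case: (col x y).
have [||x y z i|x y|x y|x y xy e|f fI [fE ext sym _]] :=
    @extend_greedy G 'I_(max_deg G) (@sedge G) col0.
- exact: sg_sym.
- exact: sg_irrefl.
- by rewrite /col0; case: ifP => // _; case: ifP => // _; apply: pcol.
- by rewrite /col0; case: ifP => // /and3P[].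
- rewrite /col0 andbCA [y -- x]sg_sym; case: ifP => // /and3P[yS xS xy].
  by have [_ ->] := scol x y xS yS xy.
- have cardE z : #|sedge z| = deg z by apply: eq_card => t; rewrite inE.
  rewrite !cardE card_ord; have := deg_le_max x; have := deg_le_max y.
  by case/orP: (colN _ _ e xy) => /pendant; lia.
apply/edge_colorableP; exists f => // x y xy; rewrite fE xy; split=> //.
have [/sym//|c0] := eqVneq (col0 x y) None.
have sym0 : col0 x y = col0 y x.
  move: c0; rewrite /col0 [y -- x]sg_sym andbCA; case: ifP => // /and3P[yS xS _] _.
  by have [] := scol x y xS yS xy.
by rewrite !ext // -sym0.
Qed.

End Star.

(** * The centre of a tree 2-spanner *)

Section Center.
Variables (G : sgraph) (F : {set {set G}}).
Hypothesis spannerF : tree_spanner 2 F.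
Local Notation T := (spanning_subgraph G F).
Local Notation "x ~~> y" := (spanning_edge F x y) (at level 30).
Implicit Types a b c x y z t : G.

Lemma spanner_sub x y : x ~~> y -> x -- y.
Proof. by case: spannerF => /subsetP sF _ _ /andP[_ /sF]; rewrite mem_edges. Qed.

Lemma spanner_sym x y : (x ~~> y) = (y ~~> x).
Proof. exact: spanning_sym. Qed.

Lemma spanner_no_cycle x y z (p : seq G) :
  uniq [:: x, y, z & p] -> path (spanning_edge F) x (y :: z :: rcons p x) -> False.
Proof.
case: spannerF => _ [_ acycT] _ up cp.
by have := acycT [:: x, y, z & p]; rewrite /ucycle up /cycle !rcons_cons cp => /(_ isT).
Qed.

Lemma spanner_mid x y : x -- y -> x ~~> y \/ exists2 z, x ~~> z & z ~~> y.
Proof.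
move=> xy; have nxy := edge_neq xy.
case: spannerF => _ [connT _] /(_ _ _ xy); rewrite /dist.
set hop := (fun k => [exists p : k.-tuple T, _]) => le2.
have hopP k : hop k -> exists2 p : seq G, size p = k & path (spanning_edge F) x p /\ last x p = y.
  by case/existsP=> p /andP[pp /eqP lp]; exists p; rewrite ?size_tuple.
have [hasp|] := boolP (has hop (iota 0 #|T|)).
  have := nth_find 0 hasp; move: hasp; rewrite has_find size_iota => ltT.
  rewrite nth_iota // add0n => /hopP[p sp [pp lp]].
  move: le2; rewrite -sp; case: p pp lp {sp} => [_ /= e|z [|t [|//]]] /=.
  - by rewrite e eqxx in nxy.
  - by rewrite andbT => xz <-; left.
  - by case/and3P=> xz zt _ <-; right; exists z.
(* If the search finds no walk, [dist] takes its default value [#|T|], so there are at most two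
   vertices. The first step of a tree path from [x] to [y] then already reaches [y]. *)
move=> nohas; move: le2; rewrite hasNfind // size_iota => le2.
have /forallP/(_ x)/forallP/(_ y)/connectP[p pp lp] := connT.
case: p pp lp => [_ /= e|z p /= /andP[xz _] _]; first by rewrite e eqxx in nxy.
have nxz := edge_neq (spanner_sub xz).
left; case: (eqVneq z y) => [<- //|nzy].
have : #|[set x; y; z]| <= 2 by apply: leq_trans le2; apply: max_card.
by rewrite -setUA cardsU1 cards2 !inE negb_or nxy nxz eq_sym nzy.
Qed.

Lemma spanner_no_triangle x y z : x ~~> y -> y ~~> z -> z ~~> x -> False.
Proof.
move=> xy yz zx; apply: (@spanner_no_cycle x y z [::]); last by rewrite /= xy yz zx.
have := edge_neq (spanner_sub xy); have := edge_neq (spanner_sub yz).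
by have := edge_neq (spanner_sub zx); rewrite /= !inE negb_or eq_sym => -> -> ->.
Qed.

(** Otherwise [x z y t] would be a 4-cycle in the tree. *)
Lemma spanner_common x y z t : x != y -> x ~~> z -> z ~~> y -> x ~~> t -> t ~~> y -> z = t.
Proof.
move=> nxy xz zy xt ty; apply/eqP; apply: contraT => nzt.
case: (@spanner_no_cycle x z y [:: t]); last by rewrite /= xz zy spanner_sym ty spanner_sym xt.
have := edge_neq (spanner_sub xz); have := edge_neq (spanner_sub zy).
have := edge_neq (spanner_sub xt); have := edge_neq (spanner_sub ty).
rewrite /= !inE !negb_or nxy nzt eq_sym => -> -> -> ->.
by [].
Qed.

Variables X Y : {set G}.
Hypothesis splitXY : split_graph X Y.

(** In the tree, [x] is within distance 2 of both [a] and [b]. If these short paths avoid [z], they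
    close a cycle with the path [a z b]. *)
Lemma hub_of_nonadjacent a b z : a \in X -> b \in X -> a != b ->
  ~~ (a ~~> b) -> a ~~> z -> z ~~> b -> forall x, x \in X -> x != z -> z ~~> x.
Proof.
move=> aX bX nab Nab az zb x xX nxz.
have [-> | nxa] := eqVneq x a; first by rewrite spanner_sym.
have [-> // | nxb] := eqVneq x b.
have ne u v : u ~~> v -> u != v by move=> /spanner_sub/edge_neq.
have ne' u v : u ~~> v -> v != u by rewrite spanner_sym => /ne.
have nadj u v : u ~~> v -> (u == a) && (v == b) = false.
  by move=> uv; apply: contraNF Nab => /andP[/eqP<- /eqP<-].
have nadj' u v : u ~~> v -> (u == b) && (v == a) = false.
  by move=> uv; apply: contraNF Nab => /andP[/eqP<- /eqP<-]; rewrite spanner_sym.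
(* Four cases, by whether the paths from [x] to [a] and to [b] have a middle vertex. The cycles have
   length 4 if neither has one, 5 if just one has, and 6 if both have distinct ones; a shared one
   other than [z] would be a second common neighbour of [a] and [b]. *)
have [xa|[p xp pa]] := spanner_mid (split_clique splitXY xX aX nxa);
have [xb|[q xq qb]] := spanner_mid (split_clique splitXY xX bX nxb).
- by case/eqP: nxz; apply: (@spanner_common a b) => //; rewrite spanner_sym.
- have [e|nqz] := eqVneq q z; first by rewrite spanner_sym -e.
  have nqa : q != a by apply: contraTneq qb => ->.
  case: (@spanner_no_cycle a z b [:: q; x]); last by
    rewrite /= az zb [b ~~> q]spanner_sym qb [q ~~> x]spanner_sym xq xa.
  by rewrite /= !inE !negb_or nab (ne _ _ az) [a == q]eq_sym nqa [a == x]eq_sym nxa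
       (ne _ _ zb) [z == q]eq_sym nqz [z == x]eq_sym nxz (ne' _ _ qb) [b == x]eq_sym nxb (ne' _ _ xq).
- have [e|npz] := eqVneq p z; first by rewrite spanner_sym -e.
  have npb : p != b by apply: contraTneq pa => ->; rewrite spanner_sym.
  case: (@spanner_no_cycle b z a [:: p; x]); last by
    rewrite /= [b ~~> z]spanner_sym zb [z ~~> a]spanner_sym az [a ~~> p]spanner_sym pa
      [p ~~> x]spanner_sym xp xb.
  by rewrite /= !inE !negb_or [b == a]eq_sym nab (ne' _ _ zb) [b == p]eq_sym npb [b == x]eq_sym nxb
       (ne' _ _ az) [z == p]eq_sym npz [z == x]eq_sym nxz (ne' _ _ pa) [a == x]eq_sym nxa (ne' _ _ xp).
- have [e|npz] := eqVneq p z; first by rewrite spanner_sym -e.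
  have [e|nqz] := eqVneq q z; first by rewrite spanner_sym -e.
  have npb : p != b by apply: contraTneq pa => ->; rewrite spanner_sym.
  have nqa : q != a by apply: contraTneq qb => ->.
  have [e|npq] := eqVneq p q.
    by case/eqP: npz; apply: (@spanner_common a b) => //; rewrite ?e // spanner_sym -e.
  case: (@spanner_no_cycle a z b [:: q; x; p]); last by
    rewrite /= az zb [b ~~> q]spanner_sym qb [q ~~> x]spanner_sym xq xp pa.
  by rewrite /= !inE !negb_or nab (ne _ _ az) [a == q]eq_sym nqa [a == x]eq_sym nxa (ne' _ _ pa)
       (ne _ _ zb) [z == q]eq_sym nqz [z == x]eq_sym nxz [z == p]eq_sym npz
       (ne' _ _ qb) [b == x]eq_sym nxb [b == p]eq_sym npb (ne' _ _ xq) [q == p]eq_sym npq (ne _ _ xp).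
Qed.

(** If two vertices of [X] are not adjacent in the tree, the vertex between them is joined to all of
    [X]; otherwise any vertex of [X] serves. *)
Lemma spanner_hub (x0 : G) : exists2 c, c \in X & forall x, x \in X -> x != c -> c ~~> x.
Proof.
case: (splitXY) => _ _ maxX _.
(* By maximality of the clique, a vertex adjacent to all others of [X] is in [X]. *)
have joinX z : (forall x, x \in X -> x != z -> z -- x) -> z \in X.
  move=> zX; rewrite -(maxsetsup maxX _ (subsetUr [set z] X)) ?setU11 //.
  apply/forall_inP=> u; rewrite in_setU1 => uzX; apply/forall_inP=> v; rewrite in_setU1 => vzX.
  apply/implyP=> nuv; case/orP: uzX => [/eqP eu|uX]; case/orP: vzX => [/eqP ev|vX].
  - by rewrite eu ev eqxx in nuv.
  - by rewrite eu zX // -eu eq_sym.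
  - by rewrite sg_sym ev zX // -ev.
  - exact: (split_clique splitXY uX vX nuv).
have [/existsP[a /existsP[b /and4P[aX bX nab Nab]]]|adj] := boolP
  [exists a, exists b, [&& a \in X, b \in X, a != b & ~~ (a ~~> b)]].
  have [ab|[z az zb]] := spanner_mid (split_clique splitXY aX bX nab).
    by rewrite ab in Nab.
  have zX := hub_of_nonadjacent aX bX nab Nab az zb.
  by exists z => //; apply: joinX => x xX /(zX x xX)/spanner_sub.
(* An empty [X] is not maximal: [x0] would vacuously join it. *)
have [X0|/set0Pn[c cX]] := eqVneq X set0.
  by have := joinX x0; rewrite X0 in_set0 => h; suff: false by []; apply: h => x; rewrite in_set0.
exists c => // x xX nxc; apply: contraNT adj => ncx.
by apply/existsP; exists c; apply/existsP; exists x; rewrite cX xX eq_sym nxc.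
Qed.

(** A vertex [y] outside [N[c]] lies in [Y], and its neighbours lie in [X] and differ from [c], so
    they are tree neighbours of [c]. An edge [y x] must be in the tree, because a detour through [p]
    would close the triangle [c p x]. Two such edges would close a 4-cycle with [c]. *)
Lemma spanner_center (x0 : G) : exists c : G, forall y, y \notin closed_nbhd c -> deg y <= 1.
Proof.
have [c cX hub] := spanner_hub x0; exists c => y.
rewrite !inE negb_or => /andP[nyc Ncy].
have yY : y \in Y.
  case/orP: (split_cover splitXY y) => // yX.
  by rewrite (split_clique splitXY cX yX) // eq_sym in Ncy.
have nbX x : y -- x -> x \in X.
  move=> yx; case/orP: (split_cover splitXY x) => // xY.
  by rewrite (negbTE (split_indep splitXY yY xY)) in yx.
have nbc x : y -- x -> x != c by apply: contraTneq => ->; rewrite sg_sym.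
have direct x : y -- x -> y ~~> x.
  move=> yx; have [//|[p yp px]] := spanner_mid yx.
  have yp' := spanner_sub yp.
  have cp := hub _ (nbX _ yp') (nbc _ yp'); have cx := hub _ (nbX _ yx) (nbc _ yx).
  by case: (spanner_no_triangle cp px); rewrite spanner_sym.
rewrite leqNgt; apply/negP => /card_gt1P[u [v [+ + nuv]]]; rewrite !inE => yu yv.
case/eqP: nuv; apply: (@spanner_common y c) => //; rewrite ?direct //.
  by rewrite spanner_sym hub ?nbX ?nbc.
by rewrite spanner_sym hub ?nbX ?nbc.
Qed.

End Center.

Theorem theorem7 (G : sgraph) (X Y : {set G}) :
  connected G -> split_graph X Y -> stretch_index_is G 2 ->
  ~~ odd (max_deg G) ->
  class2 G <-> neighborhood_overfull G.
Proof.
move=> _ splitXY [[F spannerF] _] evD; split; last exact: neighborhood_overfull_class2.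
rewrite /class2 class1E; apply: contraR => nover.
(* A centre exists only if there is a vertex; the graph without vertices is coloured trivially. *)
have [x0 _|G0] := pickP (@predT G).
  have [c pendant] := spanner_center spannerF splitXY x0.
  exact: (color_from_center splitXY pendant evD nover).
apply/edge_colorableP; exists (fun _ _ => None) => // x.
by have := G0 x.
Qed.
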